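(* Let $A$ be a commutative unitary ring with $\mathbb{Z}\subset A\subset\mathbb{R}$. The following are equivalent: (i) $H^1(W,A\Phi)=0$; (ii) $C_\Phi\in\mathrm{GL}_n(A)$.
   Context: $V$ is a Euclidean space with inner product $\langle-,-\rangle$, and $\Phi\subset V$ is an irreducible (reduced) crystallographic root system spanning $V$, with simple system $\Delta=\{\alpha_1,\dots,\alpha_n\}$ and Weyl group $W$. For $\alpha\in\Phi$, $\alpha^\vee=2\alpha/\langle\alpha,\alpha\rangle$. The Cartan matrix is $C_\Phi=(h_{ij})_{1\le i,j\le n}$ with $h_{ij}=\langle\alpha_i,\alpha_j^\vee\rangle$. $A\Phi$ is the $A$-submodule of $V$ generated by $\Phi$; it is a $W$-module, and $H^1(W,A\Phi)$ is the first group cohomology. *)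

(* Defs.v *)
From HB Require Import structures.
From mathcomp Require Import all_boot all_order all_algebra.
From mathcomp Require Import finmap all_classical reals.

Set Implicit Arguments.
Unset Strict Implicit.
Unset Printing Implicit Defensive.

Import Order.TTheory GRing.Theory Num.Theory.
Local Open Scope ring_scope.

(* Left modules over a possibly infinite group: the finiteness of a Weyl group
   is a theorem, so [finGroupType] is not available for it. *)
Record gmodule (G : groupType) := GModule {
  gmod_sort :> zmodType;
  gact : G -> gmod_sort -> gmod_sort;
  gact1 : forall x, gact 1%g x = x;
  gactM : forall g h x, gact (g * h)%g x = gact g (gact h x);
  gactD : forall g x y, gact g (x + y) = gact g x + gact g y
}.
Arguments gact {G M} g x : rename.

Section FirstCohomology.
Variables (G : groupType) (M : gmodule G).

Lemma gact_morphB (g : G) (x y : M) : gact g (x - y) = gact g x - gact g y.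
Proof. by apply: (addIr (gact g y)); rewrite -gactD !subrK. Qed.

Definition cocycle1 : {pred G -> M} :=
  fun c => `[< forall g h : G, c (g * h)%g = c g + gact g (c h) >].

Lemma cocycle1_zmod_closed : zmod_closed cocycle1.
Proof.
split=> [|c d /asboolP Hc /asboolP Hd]; apply/asboolP => g h.
  by rewrite -[in gact _ _](subrr 0) gact_morphB subrr addr0.
have E k : (c - d) k = c k - d k by [].
by rewrite !E Hc Hd gact_morphB opprD addrACA.
Qed.
HB.instance Definition _ := GRing.isZmodClosed.Build (G -> M) cocycle1
  cocycle1_zmod_closed.

Record Z1 := MkZ1 { Z1_fun :> G -> M; _ : Z1_fun \in cocycle1 }.
HB.instance Definition _ := [isSub for Z1_fun].
HB.instance Definition _ := [Choice of Z1 by <:].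
HB.instance Definition _ := [SubChoice_isSubZmodule of Z1 by <:].

Definition B1 : {pred Z1} :=
  fun c => `[< exists m : M, forall g : G, c g = gact g m - m >].

Lemma B1_zmod_closed : zmod_closed B1.
Proof.
split=> [|c d /asboolP[m Hm] /asboolP[n Hn]]; apply/asboolP.
  by exists 0 => g; rewrite -[in gact _ _](subrr 0) gact_morphB !subrr.
exists (m - n) => g; have -> : (c - d) g = c g - d g by [].
by rewrite Hm Hn gact_morphB !opprD addrACA.
Qed.
HB.instance Definition _ := GRing.isZmodClosed.Build Z1 B1 B1_zmod_closed.

Definition H1 : zmodType := Quotient.quot B1.

Lemma H1_eq0P :
  (forall x : H1, x = 0) <->
  (forall c : G -> M, (forall g h, c (g * h)%g = c g + gact g (c h)) ->
     exists m : M, forall g, c g = gact g m - m).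
Proof.
split=> [H0 c Hc | H0 x].
  have Zc : c \in cocycle1 by apply/asboolP.
  have : MkZ1 Zc \in B1.
    rewrite -[MkZ1 Zc]subr0 Quotient.idealrBE; apply/eqP.
    by rewrite [LHS]H0 [RHS]H0.
  by move/asboolP.
rewrite -[x]reprK -[0 : H1]reprK; apply/eqP; rewrite -Quotient.idealrBE.
by apply/asboolP/H0/asboolP; case: (repr x - repr _).
Qed.

End FirstCohomology.

Section GeneralLinearGroup.
Variables (K : fieldType) (V : vectType K).

Record GL := MkGL { GL_val :> 'End(V); GLP : lker GL_val == 0%VS }.
HB.instance Definition _ := [isSub for GL_val].
HB.instance Definition _ := [Choice of GL by <:].

Lemma GL_mul_subproof (f g : GL) : lker (f \o g)%VF == 0%VS.
Proof.
apply/lker0P => u v; rewrite !lfunE /= => E.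
by apply: (elimT lker0P (GLP g)); apply: (elimT lker0P (GLP f)).
Qed.

Lemma GL_one_subproof : lker (\1%VF : 'End(V)) == 0%VS.
Proof. by apply/lker0P => u v; rewrite !lfunE. Qed.

Lemma GL_inv_subproof (f : GL) : lker (f^-1)%VF == 0%VS.
Proof. by apply/lker0P; apply: can_inj (lker0_lfunVK (GLP f)). Qed.

Definition GL_mul (f g : GL) := MkGL (GL_mul_subproof f g).
Definition GL_one := MkGL GL_one_subproof.
Definition GL_inv (f : GL) := MkGL (GL_inv_subproof f).

Lemma GL_mulA : associative GL_mul.
Proof. by move=> f g h; apply: val_inj; rewrite /= comp_lfunA. Qed.
Lemma GL_mul1 : left_id GL_one GL_mul.
Proof. by move=> f; apply: val_inj; rewrite /= comp_lfun1l. Qed.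
Lemma GL_mulr1 : right_id GL_one GL_mul.
Proof. by move=> f; apply: val_inj; rewrite /= comp_lfun1r. Qed.
Lemma GL_mulV : left_inverse GL_one GL_inv GL_mul.
Proof. by move=> f; apply: val_inj; rewrite /= lker0_compVf ?GLP. Qed.
Lemma GL_mulrV : right_inverse GL_one GL_inv GL_mul.
Proof. by move=> f; apply: val_inj; rewrite /= lker0_compfV ?GLP. Qed.

HB.instance Definition _ :=
  isGroup.Build GL GL_mulA GL_mul1 GL_mulr1 GL_mulV GL_mulrV.

End GeneralLinearGroup.

Definition generated (G : groupType) (S : G -> Prop) : {pred G} :=
  fun g => `[< forall H : {pred G},
    group_closed H -> (forall s, S s -> s \in H) -> g \in H >].

Lemma generated_group_closed (G : groupType) (S : G -> Prop) :
  group_closed (generated S).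
Proof.
split=> [|g h /asboolP Hg /asboolP Hh]; apply/asboolP => H HH SH.
  exact: HH.1.
by apply: HH.2; [apply: Hg|apply: Hh].
Qed.

Section RootSystems.
Variables (R : realType) (V : vectType R) (dot : {dot V for idfun}).

Definition coroot (a : V) : V := (2 / dot a a) *: a.

Definition refl (a v : V) : V := v - dot v (coroot a) *: a.

Lemma refl_is_linear a : linear (refl a).
Proof.
move=> k u v; rewrite /refl linearPl scalerDl scalerBr scalerA.
by rewrite opprD addrACA.
Qed.
HB.instance Definition _ a :=
  GRing.isLinear.Build R V V _ (refl a) (refl_is_linear a).

Lemma reflK a : involutive (refl a).
Proof.
move=> v; have [->|a0] := eqVneq a 0; first by rewrite /refl !scaler0 !subr0.
have E : dot a (coroot a) = 2.
  by rewrite /coroot linearZr /= divfK // gt_eqF // neq0_dnorm_gt0.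
have Ea : refl a a = - a by rewrite /refl E scaler_nat mulr2n opprD addNKr.
rewrite -[refl a v]/(v - dot v (coroot a) *: a) linearB linearZ /= Ea scalerN.
by rewrite opprK subrK.
Qed.

Lemma reflGL_subproof a : lker (linfun (refl a)) == 0%VS.
Proof.
by apply/lker0P => u v; rewrite !lfunE; apply: (can_inj (reflK a)).
Qed.

Definition reflGL (a : V) : GL V := MkGL (reflGL_subproof a).

(* Reduced crystallographic root systems spanning V. *)
Record root_system := RootSystem {
  roots :> {fset V};
  roots_neq0 : 0 \notin roots;
  roots_span : <<enum_fset roots>>%VS = fullv;
  roots_refl : {in roots &, forall a b, refl a b \in roots};
  roots_reduced :
    {in roots, forall a (c : R), c *: a \in roots -> c = 1 \/ c = -1};
  roots_crystallographic :
    {in roots &, forall a b, dot b (coroot a) \is a Num.int}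
}.

Definition irreducible_rs (Phi : root_system) : Prop :=
  roots Phi <> fset0 /\
  forall Phi1 Phi2 : {fset V},
    roots Phi = (Phi1 `|` Phi2)%fset -> [disjoint Phi1 & Phi2]%fset ->
    {in Phi1 & Phi2, forall a b, dot a b = 0} ->
    Phi1 = fset0 \/ Phi2 = fset0.

(* The coefficients are only required to be real and of the same sign; for a
   crystallographic root system it follows that they are integers. *)
Definition simple_system (Phi : root_system) (n : nat) (D : n.-tuple V) :
    Prop :=
  [/\ {subset D <= roots Phi}, basis_of fullv D &
    {in roots Phi, forall b, exists c : 'I_n -> R,
       b = \sum_i c i *: tnth D i /\
       ((forall i, 0 <= c i) \/ (forall i, c i <= 0))}].

Definition cartan_mx (n : nat) (D : n.-tuple V) : 'M[R]_n :=
  \matrix_(i, j) dot (tnth D i) (coroot (tnth D j)).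

Section WeylGroup.
Variable Phi : root_system.

Definition weyl_pred : {pred GL V} :=
  generated (fun g => exists2 a, a \in roots Phi & g = reflGL a).

Record weyl := MkWeyl { weyl_val :> GL V; weylP : weyl_val \in weyl_pred }.
HB.instance Definition _ := [isSub for weyl_val].
HB.instance Definition _ := [Choice of weyl by <:].
HB.instance Definition _ := SubChoice_isSubGroup.Build (GL V) weyl_pred weyl
  (generated_group_closed _).

Lemma weyl_roots (w : weyl) v : (w v \in roots Phi) = (v \in roots Phi).
Proof.
pose H : {pred GL V} :=
  fun g => `[< forall u, (g u \in roots Phi) = (u \in roots Phi) >].
suff /asboolP : (w : GL V) \in H by [].
move/asboolP: (weylP w); apply; first split.
- by apply/asboolP => u; rewrite lfunE.
- move=> g h /asboolP Hg /asboolP Hh; apply/asboolP => u.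
  rewrite lfunE /= Hg -[in RHS](lker0_lfunVK (GLP h) u) Hh.
  by [].
move=> _ [a aPhi ->]; apply/asboolP => u; rewrite lfunE /=.
by apply/idP/idP => [/(roots_refl aPhi)|/(roots_refl aPhi)//]; rewrite reflK.
Qed.

Section RootModule.
Variable A : subringClosed R.

(* The A-submodule generated by Phi. *)
Definition Aspan : {pred V} := fun v =>
  `[< exists c : V -> R, (forall b, c b \in A) /\
        v = \sum_(b <- enum_fset Phi) c b *: b >].

Lemma Aspan_zmod_closed : zmod_closed Aspan.
Proof.
split=> [|u v /asboolP[c [Hc ->]] /asboolP[d [Hd ->]]]; apply/asboolP.
  by exists (fun=> 0); split=> [b|]; rewrite ?rpred0 // big1 // => b; rewrite scale0r.
exists (fun b => c b - d b); split=> [b|]; first by rewrite rpredB.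
by rewrite -sumrB; apply: eq_bigr => b _; rewrite scalerBl.
Qed.
HB.instance Definition _ := GRing.isZmodClosed.Build V Aspan Aspan_zmod_closed.

Lemma Aspan_scale k v : k \in A -> v \in Aspan -> k *: v \in Aspan.
Proof.
move=> Ak /asboolP[c [Hc ->]]; apply/asboolP.
exists (fun b => k * c b); split=> [b|]; first by rewrite rpredM.
by rewrite scaler_sumr; apply: eq_bigr => b _; rewrite scalerA.
Qed.

Lemma Aspan_root b : b \in roots Phi -> b \in Aspan.
Proof.
move=> bPhi; apply/asboolP; exists (fun x => (x == b)%:R); split=> [x|].
  by rewrite rpred_nat.
rewrite (bigD1_seq b) ?fset_uniq //= eqxx scale1r big1 ?addr0 // => x /negPf->.
by rewrite scale0r.
Qed.

Lemma Aspan_weyl (w : weyl) v : v \in Aspan -> w v \in Aspan.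
Proof.
move=> /asboolP[c [Hc ->]]; rewrite linear_sum big_seq rpred_sum // => b bPhi.
by rewrite linearZ Aspan_scale // Aspan_root // weyl_roots.
Qed.

Record root_mod := MkRootMod {
  root_mod_val :> V; root_modP : root_mod_val \in Aspan }.
HB.instance Definition _ := [isSub for root_mod_val].
HB.instance Definition _ := [Choice of root_mod by <:].
HB.instance Definition _ := [SubChoice_isSubZmodule of root_mod by <:].

Definition weyl_act (w : weyl) (x : root_mod) : root_mod :=
  MkRootMod (Aspan_weyl w (root_modP x)).

Lemma weyl_act1 x : weyl_act 1%g x = x.
Proof. by apply: val_inj; rewrite /= lfunE. Qed.
Lemma weyl_actM g h x : weyl_act (g * h)%g x = weyl_act g (weyl_act h x).
Proof. by apply: val_inj; rewrite /= lfunE. Qed.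
Lemma weyl_actD g x y : weyl_act g (x + y) = weyl_act g x + weyl_act g y.
Proof. by apply: val_inj; rewrite /= linearD. Qed.

Definition root_gmod : gmodule weyl :=
  GModule weyl_act1 weyl_actM weyl_actD.

End RootModule.
End WeylGroup.
End RootSystems.

(* Membership in GL_n(A) for a subring A of R: the inverse must have its entries
   in A as well, so that [M \in unitmx] (invertibility over R) is too weak. *)
Definition in_GL (R : realType) (A : {pred R}) (n : nat) (M : 'M[R]_n) : Prop :=
  M \is a mxOver A /\
  exists N : 'M[R]_n,
    [/\ N \is a mxOver A, M *m N = 1%:M & N *m M = 1%:M].

(* Main.v *)
(* As [W] is generated by the simple reflections [s_i], a cocycle [c] is
   determined by the values [c s_i], and [s_i^2 = 1] forces
   [c s_i = - t_i alpha_i] with [t_i] in [A].  The vector [v] with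
   [<v, alpha_i^v> = t_i] satisfies [c w = w v - v]; it is unique since the
   simple roots form a basis.  So [Z^1] is the [A]-lattice of weights and [B^1]
   the [A]-lattice of roots, and they coincide exactly when the inverse of the
   Cartan matrix, whose rows are the coordinates of the fundamental weights, has
   its entries in [A]. *)
Require Import Defs.
From mathcomp Require Import all_boot all_order all_algebra.
From mathcomp Require Import finmap all_classical reals.
From mathcomp Require Import ring.

Import GRing.Theory.
Local Open Scope ring_scope.

(** * Reflections as isometries *)

Section Reflections.
Local Set Implicit Arguments.
Local Unset Strict Implicit.
Import Order.TTheory Num.Theory.
Context {R : realType} {V : vectType R} {dot : {dot V for idfun}}.
Implicit Types a u v : V.

Lemma dotC u v : dot u v = dot v u.
Proof. by rewrite hermC expr0 mul1r. Qed.

Lemma dot_coroot v a : dot v (coroot dot a) = 2 / dot a a * dot v a.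
Proof. by rewrite /coroot linearZr. Qed.

Lemma dot_coroot_id a : a != 0 -> dot a (coroot dot a) = 2.
Proof. by move=> a0; rewrite dot_coroot divfK // gt_eqF // neq0_dnorm_gt0. Qed.

Lemma refl_id a : refl dot a a = - a.
Proof.
have [->|a0] := eqVneq a 0; first by rewrite /refl scaler0 subr0 oppr0.
by rewrite /refl dot_coroot_id // scaler_nat mulr2n opprD addNKr.
Qed.

Lemma dot_refl a u v : dot (refl dot a u) (refl dot a v) = dot u v.
Proof.
have [->|a0] := eqVneq a 0; first by rewrite /refl !scaler0 !subr0.
have aa : dot a a != 0 by rewrite gt_eqF // neq0_dnorm_gt0.
rewrite /refl linearBl linearBr linearBr /= !linearZr !linearZl_LR /=.
by rewrite (dotC a v); field.
Qed.

(** An isometry conjugates the reflection in [b] to the reflection in the image of [b]; here the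
    isometry is its own inverse. *)
Lemma refl_conj a b v :
  refl dot (refl dot a b) v = refl dot a (refl dot b (refl dot a v)).
Proof.
rewrite [refl dot b _]/refl linearB linearZ /= reflK.
rewrite [LHS]/refl; congr (_ - _ *: _).
by rewrite !dot_coroot dot_refl -(dot_refl a v) reflK.
Qed.

Lemma reflGL_conj a b :
  reflGL dot (refl dot a b) = (reflGL dot a * reflGL dot b * reflGL dot a)%g.
Proof.
apply/val_inj/lfunP => v; do 3 rewrite !lfunE /=.
exact: refl_conj.
Qed.

End Reflections.

(** Reduces the vanishing of a cocycle to generators of the group. *)
Lemma cocycle_ker_closed (G : groupType) (M : gmodule G) (c : G -> M) :
    (forall g h, c (g * h)%g = c g + gact g (c h)) ->
  group_closed (fun g => c g == 0).
Proof.
move=> Hc.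
have c1 : c 1%g = 0.
  by apply: (addrI (c 1%g)); rewrite addr0 -{2}[c 1%g]gact1 -Hc mulg1.
split=> [|g h /eqP cg /eqP ch]; rewrite unfold_in ?c1 //.
have := Hc (g / h)%g h; rewrite divgK cg ch.
by rewrite -[in gact _ _](subrr 0) gact_morphB subrr addr0 => <-.
Qed.

(** * Positive roots and induction along simple reflections *)

Section SimpleRoots.
Local Set Implicit Arguments.
Local Unset Strict Implicit.
Import Order.TTheory Num.Theory.
Context {R : realType} {V : vectType R} {dot : {dot V for idfun}}.
Context {Phi : root_system dot} {n : nat} {D : n.-tuple V}.
Hypothesis simpleD : simple_system Phi D.
Local Notation alpha := (tnth D).
Local Notation roots := Defs.roots.
Implicit Types (a b u v : V) (i j : 'I_n).

Let basisD : basis_of fullv D. Proof. by case: simpleD. Qed.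

Lemma simple_root i : alpha i \in roots Phi.
Proof. by case: simpleD => sD _ _; apply/sD/mem_tnth. Qed.

Lemma root_neq0 b : b \in roots Phi -> b != 0.
Proof. by apply: contraTneq => ->; apply: roots_neq0. Qed.

Lemma coord_simple v : v = \sum_i coord D i v *: alpha i.
Proof.
rewrite {1}(coord_basis basisD (memvf v)); apply: eq_bigr => i _.
by rewrite (tnth_nth 0).
Qed.

Lemma coord_simple_sum (c : 'I_n -> R) i :
  coord D i (\sum_j c j *: alpha j) = c i.
Proof.
rewrite -(coord_sum_free c i (basis_free basisD)); congr (coord _ _ _).
by apply: eq_bigr => j _; rewrite (tnth_nth 0).
Qed.

Lemma coord_alpha i j : coord D i (alpha j) = (i == j)%:R.
Proof. by rewrite (tnth_nth 0) coord_free ?(basis_free basisD) // eq_sym. Qed.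

Lemma coord_refl_simple i j v :
  coord D j (refl dot (alpha i) v) =
  coord D j v - dot v (coroot dot (alpha i)) * (j == i)%:R.
Proof. by rewrite /refl linearB linearZ /= coord_alpha. Qed.

Definition positive b := [forall i, 0 <= coord D i b].

Lemma positiveVopp b : b \in roots Phi -> positive b || positive (- b).
Proof.
move=> bPhi; case: simpleD => _ _ /(_ b bPhi)[c [-> []] Hc].
  by apply/orP; left; apply/forallP => i; rewrite coord_simple_sum.
apply/orP; right; apply/forallP => i.
by rewrite linearN /= coord_simple_sum oppr_ge0.
Qed.

Lemma root_opp b : b \in roots Phi -> - b \in roots Phi.
Proof. by move=> bPhi; rewrite -(@refl_id _ _ dot) roots_refl. Qed.

(* If only the [i]-th coordinate of [b] is nonzero
   then [b = alpha i], because the root system is reduced. *)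
Lemma positive_refl_simple i b :
    b \in roots Phi -> positive b -> b != alpha i ->
  positive (refl dot (alpha i) b).
Proof.
move=> bPhi /forallP b_ge0 bi.
have [j ji bj] : exists2 j, j != i & coord D j b != 0.
  apply/exists_inP; apply: contraNT bi => /exists_inPn b0.
  have Eb : b = coord D i b *: alpha i.
    rewrite {1}[b]coord_simple (bigD1 i) //= big1 ?addr0 // => j /b0.
    by rewrite negbK => /eqP ->; rewrite scale0r.
  have := bPhi; rewrite Eb => /(roots_reduced (simple_root i)) [] E.
    by rewrite E scale1r.
  by have := b_ge0 i; rewrite E; rewrite oppr_ge0 ler10.
(* The reflection fixes coordinate [j], which is positive, so the image is not a negative root. *)
have /orP[//|/forallP/(_ j)] := positiveVopp (roots_refl (simple_root i) bPhi).
rewrite linearN /= coord_refl_simple (negPf ji) mulr0 subr0 oppr_ge0 => bj_le0.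
by case/negP: bj; rewrite eq_le bj_le0 b_ge0.
Qed.

(** Otherwise [dot b b], a nonnegative combination of the [dot b (alpha i)], would be at most 0. *)
Lemma positive_acute b :
    b \in roots Phi -> positive b ->
  exists i, 0 < dot b (coroot dot (alpha i)).
Proof.
move=> bPhi /forallP b_ge0; apply/existsP.
have : 0 < dot b b by rewrite neq0_dnorm_gt0 // root_neq0.
apply: contraTT => /existsPn b_le0; rewrite -leNgt.
rewrite {2}[b]coord_simple linear_sumr sumr_le0 // => i _.
rewrite linearZr /= mulr_ge0_le0 //.
have := b_le0 i; rewrite dot_coroot -leNgt pmulr_rle0 //.
by rewrite divr_gt0 // neq0_dnorm_gt0 // root_neq0 ?simple_root.
Qed.

Let height v := \sum_i coord D i v.

(* A positive root [b] other than [alpha i] at an acute angle with [alpha i] is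
   sent by the reflection in [alpha i] to a positive root of smaller height. *)
Lemma positive_root_ind (P : V -> Prop) :
    (forall i, P (alpha i)) ->
    (forall i b, P b -> P (refl dot (alpha i) b)) ->
  forall b, b \in roots Phi -> positive b -> P b.
Proof.
move=> P1 Prefl b.
(* Heights are only known to be real, so the induction runs on the number of roots of smaller
   height. *)
pose rank x := count (fun y => height y < height x) (enum_fset Phi).
have [m] := ubnP (rank b); elim: m b => // m IH b le_m bPhi b_gt0.
have [i bi] := positive_acute bPhi b_gt0.
have [->//|bDi] := eqVneq b (alpha i).
have sPhi := roots_refl (simple_root i) bPhi.
rewrite -[b](@reflK _ _ dot (alpha i)); apply: Prefl; apply: IH => //; last first.
  exact: positive_refl_simple.
have lt_h : height (refl dot (alpha i) b) < height b.
  rewrite /height [ltRHS](bigD1 i) //= (bigD1 i) //=.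
  rewrite coord_refl_simple eqxx mulr1 ltr_leD ?ltrBlDr ?ltrDl //.
  by apply: ler_sum => j ji; rewrite coord_refl_simple (negPf ji) mulr0 subr0.
set sb := refl _ _ _ in sPhi lt_h *.
rewrite -ltnS; apply: leq_trans le_m; rewrite ltnS /rank.
(* The root [sb] counts towards the rank of [b] but not towards its own, so the rank drops. *)
have : (0 < count_mem sb (enum_fset Phi))%N by rewrite -has_count has_pred1.
rewrite -(ltn_add2l (count (fun y => height y < height sb) (enum_fset Phi))).
rewrite addn0 => /leq_trans -> //; rewrite -count_predUI.
rewrite [X in (_ + X)%N](eq_count (a2 := pred0)) ?count_pred0 ?addn0.
  by apply: sub_count => y /orP[/lt_trans->//|/eqP->].
by move=> y /=; apply/andP => -[/[swap]/eqP->]; rewrite ltxx.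
Qed.

Lemma root_ind (P : V -> Prop) :
    (forall i, P (alpha i)) ->
    (forall i b, P b -> P (refl dot (alpha i) b)) ->
  forall b, b \in roots Phi -> P b.
Proof.
move=> P1 Prefl b bPhi.
(* Carrying both signs through the induction reaches the negative roots. *)
pose Q x := P x /\ P (- x).
have Q1 i : Q (alpha i).
  by split=> //; rewrite -(@refl_id _ _ dot); apply: Prefl.
have Qrefl i x : Q x -> Q (refl dot (alpha i) x).
  by case=> Px PNx; split; last rewrite -linearN; apply: Prefl.
have /orP[b_gt0|b_lt0] := positiveVopp bPhi.
  by case: (positive_root_ind Q1 Qrefl bPhi b_gt0).
rewrite -[b]opprK.
by case: (positive_root_ind Q1 Qrefl (root_opp bPhi) b_lt0).
Qed.

(** * Integrality of root coordinates *)

Lemma cartan_int i j : cartan_mx dot D i j \is a Num.int.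
Proof.
rewrite mxE; exact: (roots_crystallographic (simple_root j) (simple_root i)).
Qed.

(** A simple reflection changes one coordinate, by an integer combination of Cartan integers. *)
Lemma root_coord_int b i : b \in roots Phi -> coord D i b \is a Num.int.
Proof.
move=> bPhi; move: b bPhi i.
apply: root_ind => [j i|j b Hb i]; first by rewrite coord_alpha natr_int.
rewrite coord_refl_simple; apply: rpredB => //.
apply: rpredM; last exact: natr_int.
rewrite [b]coord_simple linear_sumlz rpred_sum // => k _.
by rewrite linearZl_LR /= rpredM //; have := cartan_int k j; rewrite mxE.
Qed.

(** * Generation of the Weyl group by simple reflections *)

Lemma simple_refl_weyl i : reflGL dot (alpha i) \in weyl_pred Phi.
Proof.
by apply/asboolP => K KK; apply; exists (alpha i) => //; apply: simple_root.
Qed.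

Definition simple_refl i : weyl Phi := MkWeyl (simple_refl_weyl i).

Lemma simple_reflE i v : simple_refl i v = refl dot (alpha i) v.
Proof. by rewrite lfunE. Qed.

Lemma weyl_simple_ind (P : {pred weyl Phi}) :
  group_closed P -> (forall i, simple_refl i \in P) -> forall w, w \in P.
Proof.
move=> [P1 PV] Ps w.
(* [weyl_pred] quantifies over subgroups of [GL V], so [P] is replaced by its image there. *)
pose H : {pred GL V} :=
  fun g => `[< exists2 s : weyl Phi, weyl_val s = g & s \in P >].
have HH : group_closed H.
  split=> [|_ _ /asboolP[s <- Hs] /asboolP[t <- Ht]]; apply/asboolP.
    by exists 1%g.
  by exists (s / t)%g => //; apply: PV.
suff /asboolP[s] : weyl_val w \in H by move/val_inj => ->.
have /asboolP := weylP w; apply=> // _ [b bPhi ->]; move: b bPhi.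
have Hs i : reflGL dot (alpha i) \in H.
  by apply/asboolP; exists (simple_refl i).
apply: root_ind => // i b Hb.
have HM g h : g \in H -> h \in H -> (g * h)%g \in H.
  by move=> Hg Hh; rewrite -[h]invgK HH.2 // group_closedV.
by rewrite reflGL_conj !HM.
Qed.

(** * The Cartan matrix and weights *)

Lemma dot_coroot_mx v j :
  dot v (coroot dot (alpha j)) = ((\row_i coord D i v) *m cartan_mx dot D) 0 j.
Proof.
rewrite {1}[v]coord_simple linear_sumlz mxE; apply: eq_bigr => i _.
by rewrite linearZl_LR !mxE.
Qed.

(** The difference is orthogonal to every simple root, hence to itself. *)
Lemma coroot_separates u v :
    (forall j, dot u (coroot dot (alpha j)) = dot v (coroot dot (alpha j))) ->
  u = v.
Proof.
move=> Euv; apply/eqP; rewrite -subr_eq0; apply/negP => /negP uv_neq0.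
have := neq0_dnorm_gt0 (s := dot) _ uv_neq0.
rewrite {2}[u - v]coord_simple linear_sumr big1 ?ltxx // => j _.
have := Euv j; rewrite !dot_coroot => /mulfI E.
rewrite linearZr /= linearBl /= E ?subrr ?mulr0 //.
by rewrite gt_eqF // divr_gt0 // neq0_dnorm_gt0 // root_neq0 ?simple_root.
Qed.

(** A row in the left kernel holds the coordinates of a vector orthogonal to all simple coroots. *)
Lemma cartan_unitmx : cartan_mx dot D \in unitmx.
Proof.
rewrite -row_free_unit; apply: inj_row_free => x xC0.
have Ex : \row_i coord D i (\sum_j x 0 j *: alpha j) = x.
  by apply/rowP => i; rewrite mxE coord_simple_sum.
rewrite -Ex (_ : \sum_j _ = 0).
  by apply/rowP => i; rewrite !mxE linear0.
apply: coroot_separates => j; rewrite dot_coroot_mx Ex xC0 mxE.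
by rewrite linear0l.
Qed.

(** The vector whose pairings with the simple coroots are the entries of [t]; unit rows give the
    fundamental weights. *)
Definition weight (t : 'rV[R]_n) : V :=
  \sum_i (t *m invmx (cartan_mx dot D)) 0 i *: alpha i.

Lemma dot_weight t j : dot (weight t) (coroot dot (alpha j)) = t 0 j.
Proof.
rewrite dot_coroot_mx (_ : \row_i _ = t *m invmx (cartan_mx dot D)).
  by rewrite mulmxKV ?cartan_unitmx.
by apply/rowP => i; rewrite mxE coord_simple_sum.
Qed.

(** * Lattices over [A] and cocycles *)

Context {A : subringClosed R}.

(** Roots have integer coordinates, and [A] contains the integers. *)
Lemma Aspan_coordP v : v \in Aspan Phi A <-> forall i, coord D i v \in A.
Proof.
split=> [/asboolP[c [Ac ->]] i|Av].
  rewrite linear_sum big_seq rpred_sum //= => b bPhi.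
  rewrite linearZ rpredM //=.
  by have /intrP[m ->] := root_coord_int i bPhi; rewrite rpred_int.
rewrite [v]coord_simple rpred_sum // => i _.
by rewrite Aspan_scale // Aspan_root // simple_root.
Qed.

Lemma in_GL_cartan :
  in_GL A (cartan_mx dot D) <-> invmx (cartan_mx dot D) \is a mxOver A.
Proof.
split=> [[_ [N [AN CN _]]]|AN].
  by rewrite -[invmx _]mulmx1 -CN mulKmx // cartan_unitmx.
split; first by apply/mxOverP => i j; have /intrP[m ->] := cartan_int i j;
  rewrite rpred_int.
by exists (invmx (cartan_mx dot D)); rewrite mulmxV ?mulVmx ?cartan_unitmx.
Qed.

(** Makes the coboundary of a weight outside the root lattice a cocycle with values in that
    lattice. *)
Lemma weyl_sub_Aspan v :
    (forall j, dot v (coroot dot (alpha j)) \in A) ->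
  forall w : weyl Phi, w v - v \in Aspan Phi A.
Proof.
move=> Av w; pose P : {pred weyl Phi} := fun s => s v - v \in Aspan Phi A.
have PE s : (s \in P) = (s v - v \in Aspan Phi A) by [].
rewrite -PE; apply: weyl_simple_ind => [|i]; last first.
  rewrite PE simple_reflE /refl addrAC subrr add0r rpredN.
  by rewrite Aspan_scale // Aspan_root // simple_root.
split=> [|g h]; rewrite !PE /=; first by rewrite lfunE subrr rpred0.
move=> Pg Ph.
have Eh : (h^-1)%g v - v = - (h^-1)%g (h v - v).
  rewrite linearB opprB /=; congr (_ - _).
  have : (h^-1 * h)%g v = v by rewrite mulVg lfunE.
  by rewrite lfunE.
have -> : (g / h)%g v - v = g ((h^-1)%g v - v) + (g v - v).
  by rewrite linearB addrA subrK lfunE.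
by rewrite rpredD // Aspan_weyl // Eh rpredN Aspan_weyl.
Qed.

Lemma cocycle_simple_refl (c : weyl Phi -> root_gmod Phi A) i :
    (forall g h, c (g * h)%g = c g + gact g (c h)) ->
  val (c (simple_refl i)) = coord D i (val (c (simple_refl i))) *: alpha i.
Proof.
move=> Hc.
have c1 : c 1%g = 0.
  by apply: (addrI (c 1%g)); rewrite addr0 -{2}[c 1%g]gact1 -Hc mulg1.
have ss : (simple_refl i * simple_refl i)%g = 1%g.
  by apply/val_inj/val_inj/lfunP => v; rewrite /= !lfunE /= !lfunE /= reflK.
have /(congr1 val) := Hc (simple_refl i) (simple_refl i).
rewrite ss c1 /=; set u : V := val (c _).
rewrite -/u /= lfunE /= => E.
(* By [E], [u] is negated by the reflection. The halving takes place in [R], as 2 need not be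
   invertible in [A]. *)
have Eu : u = (dot u (coroot dot (alpha i)) / 2) *: alpha i.
  rewrite mulrC -scalerA; apply: (canRL (scalerK _)); first by rewrite pnatr_eq0.
  apply/eqP; rewrite -subr_eq0; apply/eqP; rewrite E /refl addrA.
  by rewrite scaler_nat mulr2n.
by rewrite {2}Eu linearZ /= coord_alpha eqxx mulr1.
Qed.

Lemma cocycle_simple_eq0 (c : weyl Phi -> root_gmod Phi A) :
    (forall g h, c (g * h)%g = c g + gact g (c h)) ->
    (forall i, c (simple_refl i) = 0) ->
  forall w, c w = 0.
Proof.
move=> Hc c0 w; apply/eqP.
have : w \in (fun g => c g == 0 : bool) by
  apply: weyl_simple_ind (cocycle_ker_closed _ _ _ Hc) _ w => i; apply/eqP/c0.
by [].
Qed.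

End SimpleRoots.

(** * The equivalence *)

Theorem theorem3p2 (R : realType) (V : vectType R) (dot : {dot V for idfun})
  (Phi : root_system dot) (n : nat) (D : n.-tuple V) (A : subringClosed R) :
  irreducible_rs Phi ->
  simple_system Phi D ->
  ((forall x : H1 (root_gmod Phi A), x = 0) <-> in_GL A (cartan_mx dot D)).
Proof.
move=> _ simpleD; rewrite H1_eq0P (in_GL_cartan simpleD); split=> [H0|AN c Hc].
  apply/mxOverP => i j.
  (* The coordinates of this fundamental weight form row [i] of the inverse Cartan matrix. *)
  pose omega := weight (dot := dot) (D := D) (delta_mx 0 i).
  have Aomega k : dot omega (coroot dot (tnth D k)) \in A.
    by rewrite (dot_weight simpleD) mxE rpred_nat.
  have Aw := weyl_sub_Aspan simpleD Aomega.
  pose c w : root_gmod Phi A := MkRootMod (Aw w).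
  have [|m Hm] := H0 c.
    by move=> g h; apply: val_inj; rewrite /= linearB /= lfunE [RHS]addrC addrA subrK.
  (* Equal coboundaries at the simple reflections force equal pairings with the simple coroots. *)
  have Eomega : omega = val m.
    apply: (coroot_separates simpleD) => k.
    have /(congr1 val) := Hm (simple_refl simpleD k).
    rewrite /= !lfunE /= /refl ![_ - _ *: _ - _]addrAC !subrr !add0r => /oppr_inj.
    move/(congr1 (coord D k)); rewrite !linearZ /= (coord_alpha simpleD).
    by rewrite eqxx !mulr1.
  have /(Aspan_coordP simpleD)/(_ j) : omega \in Aspan Phi A.
    by rewrite Eomega; apply: root_modP.
  by rewrite (coord_simple_sum simpleD) -rowE mxE.
pose s := simple_refl simpleD.
(* The sign is needed because [s i] moves a vector by minus its pairing times [alpha i]. *)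
pose t := \row_i - coord D i (val (c (s i))).
have At i : t 0 i \in A.
  rewrite mxE rpredN; have := root_modP (c (s i)).
  by move=> /(Aspan_coordP simpleD).
have Aweight : weight (dot := dot) (D := D) t \in Aspan Phi A.
  apply/(Aspan_coordP simpleD) => i; rewrite (coord_simple_sum simpleD) mxE.
  by rewrite rpred_sum // => j _; rewrite rpredM // (mxOverP AN).
pose m : root_gmod Phi A := MkRootMod Aweight.
(* The error [e] is a cocycle that vanishes on the simple reflections, hence everywhere. *)
pose e g : root_gmod Phi A := c g - (gact g m - m).
have He g h : e (g * h)%g = e g + gact g (e h).
  rewrite /e Hc gactM !gact_morphB [RHS]addrACA -opprD.
  by rewrite [in RHS](addrC (gact g m - m)) addrA subrK.
exists m => w; apply/eqP; rewrite -subr_eq0; apply/eqP.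
move: w; apply: (cocycle_simple_eq0 (simpleD := simpleD) He) => i; apply: val_inj.
rewrite /e /= (cocycle_simple_refl simpleD _ Hc) lfunE /= /refl.
by rewrite (dot_weight simpleD) mxE addrAC subrr add0r scaleNr opprK subrr.
Qed.
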